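(* Let $A$ be a finite-dimensional associative algebra over a field $k$ with basis $\{e_i\}$ and structure constants $c_{ij}{}^k\in k$ defined by $e_ie_j=\sum_k c_{ij}{}^k e_k$. Then the extended comeasuring bialgebra $M_1(A)$ is the associative unital algebra generated by $1$ and a matrix $(t^i{}_j)$ of generators, with the relations $$\sum_a c_{ij}{}^a\, t^k{}_a=\sum_{a,b}c_{ab}{}^k\, t^a{}_i t^b{}_j\qquad\text{for all } i,j,k,$$ and with coproduct and counit $$\Delta t^i{}_j=\sum_a t^i{}_a\otimes t^a{}_j,\qquad \epsilon(t^i{}_j)=\delta^i{}_j .$$ The universal coaction is the map $\beta_U(e_i)=\sum_a e_a\otimes t^a{}_i$.
   Context: For an associative, not necessarily unital, algebra $A$, a (nonunital) comeasuring of $A$ is a pair $(B,\beta)$ with $B$ an associative, not necessarily unital, algebra and $\beta:A\to A\otimes B$ a (not necessarily unit-preserving) algebra map. The nonunital comeasuring bialgebra is the initial such pair $(M,\beta_U)$: for every comeasuring $(B,\beta)$ there is a unique (not necessarily unital) algebra map $\pi:M\to B$ with $\beta=(\mathrm{id}\otimes\pi)\beta_U$. It is a not-necessarily-unital bialgebra, with coproduct and counit determined by the universal property: $\Delta$ is the unique algebra map with $(\mathrm{id}\otimes\Delta)\beta_U=(\beta_U\otimes\mathrm{id})\beta_U$, and $\epsilon:M\to k$ is the map induced by the comeasuring $(k,\ a\mapsto a\otimes 1)$. The extended comeasuring bialgebra $M_1(A)$ is obtained from $M$ by formally adjoining a unit $1$, with $\Delta(1)=1\otimes 1$ and $\epsilon(1)=1$.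 *)

(* Defs.v *)
From HB Require Import structures.
From mathcomp Require Import all_boot all_algebra.
From mathcomp Require Import generic_quotient finmap.
From mathcomp Require Import monalg.
From mathcomp Require Import boolp classical_sets.

Set Implicit Arguments.
Unset Strict Implicit.
Unset Printing Implicit Defensive.

Import GRing.Theory.

Local Open Scope ring_scope.
Local Open Scope quotient_scope.

Reserved Notation "x ** y" (at level 40, left associativity).
Reserved Notation "v ⊗ w" (at level 40, left associativity).
Reserved Notation "{ 'nualg' A -> B }"
  (at level 0, A at level 98, B at level 99, format "{ 'nualg'  A  ->  B }").

(** * Associative, not necessarily unital, algebras *)

HB.mixin Record Lmodule_isNuAlg (k : fieldType) A of GRing.Lmodule k A := {
  numul : A -> A -> A;
  numulA : associative numul;
  numul_linearl : forall y, linear (numul^~ y);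
  numul_linearr : forall x, linear (numul x)
}.

#[short(type="nualgType")]
HB.structure Definition NuAlg (k : fieldType) :=
  {A of GRing.Lmodule k A & Lmodule_isNuAlg k A}.

Notation "x ** y" := (numul x y) : ring_scope.

#[short(type="nufalgType")]
HB.structure Definition NuFalgebra (k : fieldType) :=
  {A of NuAlg k A & Vector k A}.

HB.mixin Record isNuMultiplicative (k : fieldType) (A B : nualgType k)
    (f : A -> B) := {
  numorphM : {morph f : x y / x ** y}
}.

HB.structure Definition NuMorphism (k : fieldType) (A B : nualgType k) :=
  {f of isNuMultiplicative k A B f & @GRing.Linear k A B *:%R f}.

Notation "{ 'nualg' A -> B }" := (NuMorphism.type A%type B%type) : type_scope.

Section Regular.
Variable k : fieldType.

Lemma regular_mulA : associative (fun x y : k^o => (x : k) * (y : k) : k^o).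
Proof. exact: mulrA. Qed.

Lemma regular_mul_linearl (y : k^o) :
  linear (fun x : k^o => (x : k) * (y : k) : k^o).
Proof. by move=> a u v; rewrite /GRing.scale /= mulrDl mulrA. Qed.

Lemma regular_mul_linearr (x : k^o) :
  linear (fun y : k^o => (x : k) * (y : k) : k^o).
Proof. by move=> a u v; rewrite /GRing.scale /= mulrDr mulrCA. Qed.

HB.instance Definition _ := Lmodule_isNuAlg.Build k k^o
  regular_mulA regular_mul_linearl regular_mul_linearr.
End Regular.

(** * Quotient of a vector space by the span of a set *)

Section Quotient.
Variables (k : fieldType) (V : lmodType k) (R : set V).

Definition subspace (S : set V) :=
  S 0 /\ forall (a : k) u v, S u -> S v -> S (a *: u + v).

Definition spanned : set V :=
  fun v => forall S, subspace S -> (R `<=` S)%classic -> S v.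

Lemma spanned_subspace : subspace spanned.
Proof.
split=> [S [] //|a u v Su Sv S subS RS].
by apply: subS.2; [apply: Su | apply: Sv].
Qed.

Lemma sub_spanned : (R `<=` spanned)%classic.
Proof. by move=> v Rv S _; apply. Qed.

Lemma spanned0 : spanned 0. Proof. exact: spanned_subspace.1. Qed.

Lemma spannedZ a u : spanned u -> spanned (a *: u).
Proof.
by move=> Su; rewrite -[_ *: _]addr0; apply: spanned_subspace.2 => //; apply: spanned0.
Qed.

Lemma spannedD u v : spanned u -> spanned v -> spanned (u + v).
Proof. by move=> Su Sv; rewrite -[u]scale1r; apply: spanned_subspace.2. Qed.

Lemma spannedN u : spanned u -> spanned (- u).
Proof. by move=> Su; rewrite -scaleN1r; apply: spannedZ. Qed.

Definition quot_eqv (u v : V) : bool := `[< spanned (u - v) >].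

Lemma quot_eqv_equiv : equiv_class_of quot_eqv.
Proof.
split=> [u|u v|v u w].
- by apply/asboolP; rewrite subrr; apply: spanned0.
- by apply/asboolP/asboolP => /spannedN; rewrite opprB.
- move=> /asboolP uv /asboolP vw; apply/asboolP.
  by rewrite -(subrKA v); apply: spannedD.
Qed.

Canonical quot_eqv_rel := EquivRelPack quot_eqv_equiv.

Definition quot := {eq_quot quot_eqv}.

HB.instance Definition _ := Choice.on quot.
HB.instance Definition _ := EqQuotient.on quot.

Definition quot_pi (v : V) : quot := \pi_quot v.

Lemma quot_piP u v : quot_pi u = quot_pi v <-> spanned (u - v).
Proof.
split=> [/eqP|uv]; first by rewrite [_ == _]eqmodE => /asboolP.
by apply/eqP; rewrite [_ == _]eqmodE; apply/asboolP.
Qed.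

Lemma quot_reprK x : quot_pi (repr x) = x. Proof. exact: reprK. Qed.

Lemma quot_repr v : spanned (repr (quot_pi v) - v).
Proof. by apply/quot_piP; rewrite quot_reprK. Qed.

(* Locked: unification failures would otherwise unfold down to [repr]. *)
Definition quot_add : quot -> quot -> quot :=
  locked (fun x y => quot_pi (repr x + repr y)).
Definition quot_opp : quot -> quot := locked (fun x => quot_pi (- repr x)).
Definition quot_scale : k -> quot -> quot :=
  locked (fun a x => quot_pi (a *: repr x)).

Lemma quot_addE u v : quot_add (quot_pi u) (quot_pi v) = quot_pi (u + v).
Proof.
rewrite /quot_add -lock; apply/quot_piP; rewrite opprD addrACA.
by apply: spannedD; apply: quot_repr.
Qed.

Lemma quot_oppE u : quot_opp (quot_pi u) = quot_pi (- u).
Proof.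
rewrite /quot_opp -lock; apply/quot_piP; rewrite -opprD.
by apply: spannedN; apply: quot_repr.
Qed.

Lemma quot_scaleE a u : quot_scale a (quot_pi u) = quot_pi (a *: u).
Proof.
rewrite /quot_scale -lock; apply/quot_piP; rewrite -scalerBr.
by apply: spannedZ; apply: quot_repr.
Qed.

Lemma quotW (P : quot -> Prop) : (forall v, P (quot_pi v)) -> forall x, P x.
Proof. by move=> H x; rewrite -[x]quot_reprK. Qed.

Lemma quot_addA : associative quot_add.
Proof.
by elim/quotW => x; elim/quotW => y; elim/quotW => z; rewrite !quot_addE addrA.
Qed.

Lemma quot_addC : commutative quot_add.
Proof. by elim/quotW => x; elim/quotW => y; rewrite !quot_addE addrC. Qed.

Lemma quot_add0 : left_id (quot_pi 0) quot_add.
Proof. by elim/quotW => x; rewrite !quot_addE add0r. Qed.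

Lemma quot_addN : left_inverse (quot_pi 0) quot_opp quot_add.
Proof. by elim/quotW => x; rewrite quot_oppE quot_addE addNr. Qed.

HB.instance Definition _ :=
  GRing.isZmodule.Build quot quot_addA quot_addC quot_add0 quot_addN.

Lemma quot_piD u v : quot_pi (u + v) = quot_pi u + quot_pi v.
Proof. exact/esym/quot_addE. Qed.

Lemma quot_scaleA a b x :
  quot_scale a (quot_scale b x) = quot_scale (a * b) x.
Proof. by elim/quotW: x => x; rewrite !quot_scaleE scalerA. Qed.

Lemma quot_scale1 : left_id 1 quot_scale.
Proof. by elim/quotW => x; rewrite !quot_scaleE scale1r. Qed.

Lemma quot_scaleDr : right_distributive quot_scale +%R.
Proof.
move=> a; elim/quotW => x; elim/quotW => y.
by rewrite -quot_piD !quot_scaleE -quot_piD scalerDr.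
Qed.

Lemma quot_scaleDl x : {morph quot_scale^~ x : a b / a + b}.
Proof.
move=> a b; elim/quotW: x => x.
by rewrite !quot_scaleE -quot_piD scalerDl.
Qed.

HB.instance Definition _ := GRing.Zmodule_isLmodule.Build k quot
  quot_scaleA quot_scale1 quot_scaleDr quot_scaleDl.

Lemma quot_pi_linear : linear quot_pi.
Proof. by move=> a u v; rewrite quot_piD -quot_scaleE. Qed.

HB.instance Definition _ := GRing.isLinear.Build k V quot *:%R quot_pi
  quot_pi_linear.

End Quotient.

(** * Tensor products of vector spaces and of algebras *)

Section Tensor.
Variables (k : fieldType) (V W : lmodType k).

Local Notation free := {malg k[(V * W)%type]}.

Definition bilinearity_relators : set free := fun r =>
  (exists a v v' w, r = << (a *: v + v', w) >> - a *: << (v, w) >> - << (v', w) >>)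
  \/
  (exists a v w w', r = << (v, a *: w + w') >> - a *: << (v, w) >> - << (v, w') >>).

Definition tensor := quot bilinearity_relators.

HB.instance Definition _ := GRing.Lmodule.on tensor.

Definition tens : V -> W -> tensor :=
  locked (fun v w => quot_pi _ << (v, w) >>).

Lemma tensE v w : tens v w = quot_pi _ << (v, w) >>.
Proof. by rewrite /tens -lock. Qed.

Lemma tens_linearl w : linear (tens^~ w).
Proof.
move=> a u v; rewrite !tensE; apply: etrans (quot_pi_linear _ _ _ _).
apply/quot_piP.
by apply: sub_spanned; left; exists a, u, v, w; rewrite opprD addrA.
Qed.

Lemma tens_linearr v : linear (tens v).
Proof.
move=> a u w; rewrite !tensE; apply: etrans (quot_pi_linear _ _ _ _).
apply/quot_piP.
by apply: sub_spanned; right; exists a, v, u, w; rewrite opprD addrA.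
Qed.

Section Lift.
Variable Z : lmodType k.

Section FreeLift.
Variable f : V -> W -> Z.

Definition free_lift (g : free) : Z :=
  \sum_(p <- msupp g) g@_p *: f p.1 p.2.

Lemma free_liftEw (d : {fset (V * W)%type}) g : (msupp g `<=` d)%fset ->
  free_lift g = \sum_(p <- d) g@_p *: f p.1 p.2.
Proof.
move=> le; rewrite /free_lift (big_fset_incl _ le) // => p _.
by move=> /mcoeff_outdom ->; rewrite scale0r.
Qed.

Lemma free_lift_linear : linear free_lift.
Proof.
move=> a g h; pose d := (msupp (a *: g + h) `|` msupp g `|` msupp h)%fset.
rewrite (@free_liftEw d (a *: g + h)) ?(@free_liftEw d g) ?(@free_liftEw d h);
  last 1 first.
- by rewrite /d -fsetUA fsubsetUl.
- rewrite scaler_sumr -big_split /=; apply: eq_bigr => p _.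
  by rewrite mcoeffD mcoeffZ scalerDl scalerA.
- by rewrite /d fsubsetUr.
- by rewrite /d fsetUAC fsubsetUr.
Qed.

HB.instance Definition _ := GRing.isLinear.Build k free Z *:%R free_lift
  free_lift_linear.

Lemma free_liftU p : free_lift << p >> = f p.1 p.2.
Proof.
by rewrite (free_liftEw (msuppU_le)) big_seq_fset1 mcoeffUU scale1r.
Qed.

End FreeLift.

(* The linear map induced by [f]; meaningful only when [f] is bilinear. *)
Definition tensor_lift : (V -> W -> Z) -> tensor -> Z :=
  locked (fun f x => free_lift f (repr x)).

Variable f : V -> W -> Z.
Hypothesis f_linearl : forall w, linear (f^~ w).
Hypothesis f_linearr : forall v, linear (f v).

Lemma free_lift_spanned g : spanned bilinearity_relators g -> free_lift f g = 0.
Proof.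
move=> gS; apply: (gS (fun h => free_lift f h = 0)).
  split=> [|a u v u0 v0]; first by rewrite linear0.
  by rewrite free_lift_linear u0 v0 scaler0 addr0.
move=> _ [[a [v [v' [w ->]]]]|[a [v [w [w' ->]]]]].
  by rewrite !linearB linearZ /= !free_liftU /= f_linearl addrAC addrK subrr.
by rewrite !linearB linearZ /= !free_liftU /= f_linearr addrAC addrK subrr.
Qed.

Lemma tensor_lift_pi g : tensor_lift f (quot_pi _ g) = free_lift f g.
Proof.
rewrite /tensor_lift -lock.
apply/eqP; rewrite -subr_eq0; apply/eqP; rewrite -linearB.
by apply: free_lift_spanned; apply: quot_repr.
Qed.

Lemma tensor_lift_tens v w : tensor_lift f (tens v w) = f v w.
Proof. by rewrite tensE tensor_lift_pi free_liftU. Qed.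

Lemma tensor_lift_linear : linear (tensor_lift f).
Proof.
move=> a; elim/quotW => x; elim/quotW => y.
by rewrite -[a *: _ + _]quot_pi_linear !tensor_lift_pi free_lift_linear.
Qed.

End Lift.

Lemma tensor_ind (P : tensor -> Prop) :
  P 0 -> (forall a x y, P x -> P y -> P (a *: x + y)) ->
  (forall v w, P (tens v w)) -> forall x, P x.
Proof.
move=> P0 PD Pt; elim/quotW => g; rewrite [g]monalgE raddf_sum.
apply: big_ind => //= [x y Px Py|[v w] _].
  by rewrite -[x]scale1r; apply: PD.
have -> : << g@_(v, w) *g (v, w) >> = g@_(v, w) *: << (v, w) >> :> free.
  by apply/malgP=> p; rewrite mcoeffZ !mcoeffU mulrnAr mulr1.
rewrite -[_ *: << _ >>]addr0 quot_pi_linear raddf0; by apply: PD => //; rewrite -tensE; apply: Pt.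
Qed.

Lemma tensor_linear_ext (Z : lmodType k) (f g : tensor -> Z) :
  linear f -> linear g -> (forall v w, f (tens v w) = g (tens v w)) -> f =1 g.
Proof.
move=> fl gl fg; have z h : linear h -> h (0 : tensor) = 0 :> Z.
  by move=> hl; rewrite -[0 : tensor](addNr 0) -scaleN1r hl scaleN1r addNr.
by apply: tensor_ind => [|a x y xE yE|//]; rewrite ?z // fl gl xE yE.
Qed.

End Tensor.

Notation "v ⊗ w" := (tens v w) : ring_scope.

Section TensorMap.
Variables (k : fieldType) (V W V' W' : lmodType k).
Variables (f : {linear V -> V'}) (g : {linear W -> W'}).

Definition tensor_map : tensor V W -> tensor V' W' :=
  tensor_lift (fun v w => f v ⊗ g w).

Let linl w : linear (fun v => f v ⊗ g w).
Proof. by move=> a u v; rewrite linearP tens_linearl. Qed.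

Let linr v : linear (fun w => f v ⊗ g w).
Proof. by move=> a u w; rewrite linearP tens_linearr. Qed.

Lemma tensor_map_tens v w : tensor_map (v ⊗ w) = f v ⊗ g w.
Proof. exact: tensor_lift_tens. Qed.

Lemma tensor_map_linear : linear tensor_map.
Proof. exact: tensor_lift_linear. Qed.

HB.instance Definition _ :=
  GRing.isLinear.Build k _ _ *:%R tensor_map tensor_map_linear.

End TensorMap.

Section TensorAssoc.
Variables (k : fieldType) (U V W : lmodType k).

Definition tensor_assoc : tensor (tensor U V) W -> tensor U (tensor V W) :=
  tensor_lift (fun x w => tensor_lift (fun u v => u ⊗ (v ⊗ w)) x).

Let in_l (w : W) (v : V) : linear (fun u : U => u ⊗ (v ⊗ w)).
Proof. exact: tens_linearl. Qed.

Let in_r (w : W) (u : U) : linear (fun v : V => u ⊗ (v ⊗ w)).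
Proof. by move=> a v v'; rewrite tens_linearl tens_linearr. Qed.

Let out_l (w : W) :
  linear (fun x : tensor U V => tensor_lift (fun u v => u ⊗ (v ⊗ w)) x).
Proof. exact: tensor_lift_linear. Qed.

Let out_r (x : tensor U V) :
  linear (fun w : W => tensor_lift (fun u v => u ⊗ (v ⊗ w)) x).
Proof.
move=> a w w'; move: x; apply: tensor_linear_ext => // [|u v].
  move=> b x y; rewrite !out_l !scalerDr !scalerA [a * b]mulrC.
  by rewrite addrACA.
by rewrite !tensor_lift_tens // !tens_linearr.
Qed.

Lemma tensor_assoc_tens u v w : tensor_assoc ((u ⊗ v) ⊗ w) = u ⊗ (v ⊗ w).
Proof. by rewrite /tensor_assoc !tensor_lift_tens. Qed.

Lemma tensor_assoc_linear : linear tensor_assoc.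
Proof. exact: tensor_lift_linear. Qed.

End TensorAssoc.

Section TensorAlg.
Variables (k : fieldType) (A B : nualgType k).

Definition tensor_mul (x y : tensor A B) : tensor A B :=
  tensor_lift (fun a b => tensor_lift (fun a' b' => (a ** a') ⊗ (b ** b')) y) x.

Let in_l (a : A) (b b' : B) : linear (fun a' : A => (a ** a') ⊗ (b ** b' : B)).
Proof. by move=> c u v; rewrite numul_linearr tens_linearl. Qed.

Let in_r (a a' : A) (b : B) : linear (fun b' : B => (a ** a' : A) ⊗ (b ** b')).
Proof. by move=> c u v; rewrite numul_linearr tens_linearr. Qed.

Let in_lin (a : A) (b : B) : linear (tensor_lift (fun (a' : A) (b' : B) => (a ** a') ⊗ (b ** b'))).
Proof. exact: tensor_lift_linear. Qed.

Let out_l y b :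
  linear (fun a : A => tensor_lift (fun a' (b' : B) => (a ** a') ⊗ (b ** b')) y).
Proof.
move=> c u v; move: y; apply: tensor_linear_ext => // [|a' b'].
  move=> d x y; rewrite !in_lin !scalerDr !scalerA [c * d]mulrC.
  by rewrite addrACA.
by rewrite !tensor_lift_tens // numul_linearl tens_linearl.
Qed.

Let out_r y a :
  linear (fun b : B => tensor_lift (fun (a' : A) b' => (a ** a') ⊗ (b ** b')) y).
Proof.
move=> c u v; move: y; apply: tensor_linear_ext => // [|a' b'].
  move=> d x y; rewrite !in_lin !scalerDr !scalerA [c * d]mulrC.
  by rewrite addrACA.
by rewrite !tensor_lift_tens // numul_linearl tens_linearr.
Qed.

Lemma tensor_mul_tens a b a' b' :
  tensor_mul (a ⊗ b) (a' ⊗ b') = (a ** a') ⊗ (b ** b').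
Proof. by rewrite /tensor_mul !tensor_lift_tens. Qed.

Lemma tensor_mul_linearl y : linear (tensor_mul^~ y).
Proof. exact: tensor_lift_linear. Qed.

Lemma tensor_mul_linearr x : linear (tensor_mul x).
Proof.
move=> c y z; move: x; apply: tensor_linear_ext => [||a b].
- exact: tensor_mul_linearl.
- move=> d u v; rewrite !tensor_mul_linearl !scalerDr !scalerA [c * d]mulrC.
  by rewrite addrACA.
- by rewrite /tensor_mul !tensor_lift_tens // in_lin.
Qed.

Lemma tensor_mulA : associative tensor_mul.
Proof.
move=> x y z; move: x; apply: tensor_linear_ext => [||a b].
- exact: tensor_mul_linearl.
- by move=> c u v; rewrite !tensor_mul_linearl.
move: y; apply: tensor_linear_ext => [||a' b'].
- by move=> c u v; rewrite !tensor_mul_linearl !tensor_mul_linearr.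
- by move=> c u v; rewrite !tensor_mul_linearr !tensor_mul_linearl.
move: z; apply: tensor_linear_ext => [||a'' b''].
- by move=> c u v; rewrite !tensor_mul_linearr.
- by move=> c u v; rewrite !tensor_mul_linearr.
by rewrite !tensor_mul_tens !numulA.
Qed.

HB.instance Definition _ := Lmodule_isNuAlg.Build k (tensor A B)
  tensor_mulA tensor_mul_linearl tensor_mul_linearr.

End TensorAlg.

(** * The comeasuring bialgebra *)

(* A comeasuring of [A] is an algebra [B] with a map [beta : A -> A ⊗ B] of
   nonunital algebras.  [pi' =1 pi] is equality of maps, whatever the proof
   components of the bundled morphisms. *)

Record comeasuring_bialgebra (k : fieldType) (A : nualgType k) := {
  cm_alg :> nualgType k;
  cm_coact : {nualg A -> tensor A cm_alg};
  cm_universal : forall (B : nualgType k) (beta : {nualg A -> tensor A B}),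
    exists2 pi : {nualg cm_alg -> B},
      forall a, beta a = tensor_map idfun pi (cm_coact a)
    & forall pi' : {nualg cm_alg -> B},
      (forall a, beta a = tensor_map idfun pi' (cm_coact a)) -> pi' =1 pi;
  cm_coprod : {nualg cm_alg -> tensor cm_alg cm_alg};
  cm_coprodE : forall a, tensor_map idfun cm_coprod (cm_coact a) =
    tensor_assoc (tensor_map cm_coact idfun (cm_coact a));
  cm_counit : {nualg cm_alg -> k^o};
  cm_counitE : forall a, a ⊗ 1 = tensor_map idfun cm_counit (cm_coact a)
}.

(** * Adjoining a unit *)

Section Unitization.
Variables (k : fieldType) (M : nualgType k).

(* [(c, m)] stands for [c 1 + m]. *)
Definition unitization := (k^o * M)%type.

HB.instance Definition _ := GRing.Lmodule.on unitization.

Definition unit_mul (x y : unitization) : unitization :=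
  ((x.1 : k) * (y.1 : k),
   (x.1 : k) *: y.2 + (y.1 : k) *: x.2 + x.2 ** y.2).

Definition unit_one : unitization := (1, 0).

Let numulDl (x y z : M) : (x + y) ** z = x ** z + y ** z.
Proof. by have := numul_linearl z 1 x y; rewrite /= !scale1r. Qed.
Let numulDr (x y z : M) : x ** (y + z) = x ** y + x ** z.
Proof. by have := numul_linearr x 1 y z; rewrite /= !scale1r. Qed.
Let numul0l (x : M) : 0 ** x = 0.
Proof. by apply: (addrI (0 ** x)); rewrite -numulDl !addr0. Qed.
Let numul0r (x : M) : x ** 0 = 0.
Proof. by apply: (addrI (x ** 0)); rewrite -numulDr !addr0. Qed.
Let numulZl a (x y : M) : (a *: x) ** y = a *: (x ** y).
Proof. by have := numul_linearl y a x 0; rewrite /= !addr0 numul0l addr0. Qed.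
Let numulZr a (x y : M) : x ** (a *: y) = a *: (x ** y).
Proof. by have := numul_linearr x a y 0; rewrite /= !addr0 numul0r addr0. Qed.

Lemma unit_mulA : associative unit_mul.
Proof.
move=> [a x] [b y] [c z]; rewrite /unit_mul /=; congr pair; first exact: mulrA.
rewrite !(scalerDr, numulDl, numulDr, numulZl, numulZr, scalerA, numulA, addrA).
rewrite ![c * _]mulrC -!addrA; congr (_ + (_ + _)).
rewrite addrCA; congr (_ + _).
by rewrite [RHS]addrCA; congr (_ + _); rewrite addrCA.
Qed.

Lemma unit_mul1l : left_id unit_one unit_mul.
Proof.
by case=> a x; rewrite /unit_mul /= mul1r scale1r scaler0 numul0l !addr0.
Qed.

Lemma unit_mul1r : right_id unit_one unit_mul.
Proof.
by case=> a x; rewrite /unit_mul /= mulr1 scale1r scaler0 numul0r addr0 add0r.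
Qed.

Lemma unit_mulDl : left_distributive unit_mul +%R.
Proof.
move=> [a x] [b y] [c z]; rewrite /unit_mul /=; congr pair; first exact: mulrDl.
by rewrite /= scalerDl scalerDr numulDl [RHS]addrACA [X in _ = X + _]addrACA.
Qed.

Lemma unit_mulDr : right_distributive unit_mul +%R.
Proof.
move=> [a x] [b y] [c z]; rewrite /unit_mul /=; congr pair; first exact: mulrDr.
by rewrite /= scalerDl scalerDr numulDr [RHS]addrACA [X in _ = X + _]addrACA.
Qed.

Lemma unit_one_neq0 : unit_one != 0.
Proof. by apply/eqP => -[] /eqP; rewrite oner_eq0. Qed.

HB.instance Definition _ := GRing.Zmodule_isNzRing.Build unitization
  unit_mulA unit_mul1l unit_mul1r unit_mulDl unit_mulDr unit_one_neq0.

Lemma unit_scaleAl (a : k) (x y : unitization) : a *: (x * y) = a *: x * y.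
Proof.
case: x y => [b x] [c y]; congr pair; first exact: mulrA.
by rewrite /= !scalerDr !scalerA numulZl [c * a]mulrC.
Qed.

HB.instance Definition _ :=
  GRing.Lmodule_isLalgebra.Build k unitization unit_scaleAl.

Definition unit_inj (m : M) : unitization := (0, m).

Lemma unit_inj_linear : linear unit_inj.
Proof. by move=> a u v; congr pair; rewrite /= scaler0 addr0. Qed.

HB.instance Definition _ :=
  GRing.isLinear.Build k M unitization *:%R unit_inj unit_inj_linear.

End Unitization.

Section Extended.
Variables (k : fieldType) (A : nualgType k) (M : comeasuring_bialgebra A).

Local Notation M1 := (unitization M).

(* The linear extensions with Δ(1) = 1 ⊗ 1 and ε(1) = 1. *)
Definition extended_coprod (x : M1) : tensor M1 M1 :=
  (x.1 : k) *: ((1 : M1) ⊗ (1 : M1)) +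
  tensor_map (@unit_inj k M) (@unit_inj k M) (cm_coprod M x.2).

Definition extended_counit (x : M1) : k := (x.1 : k) + cm_counit M x.2.

End Extended.

Arguments extended_coprod {k A} M x.
Arguments extended_counit {k A} M x.

(** * Algebras given by generators and relations *)

Definition two_sided_ideal (F : nzRingType) (J : set F) :=
  [/\ J 0, forall x y, J x -> J y -> J (x + y),
      forall a x, J x -> J (a * x) & forall a x, J x -> J (x * a)].

Definition generated_ideal (F : nzRingType) (R : set F) : set F :=
  fun p => forall J, two_sided_ideal J -> (R `<=` J)%classic -> J p.

Definition free_algebra (k : fieldType) (I : choiceType) : lalgType k :=
  {malg k[{fmonom I}]}.

Definition free_gen (k : fieldType) (I : choiceType) (i : I) :
  free_algebra k I := << fmu i >>.

(* The free algebra maps onto [C], with kernel the ideal generated by [R]. *)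
Definition presented_by (k : fieldType) (C : lalgType k) (I : choiceType)
    (gen : I -> C) (R : set (free_algebra k I)) :=
  exists phi : {lrmorphism free_algebra k I -> C},
    [/\ forall i, phi (free_gen k i) = gen i,
        forall x, exists p, phi p = x
      & forall p, phi p = 0 <-> generated_ideal R p].

Section Relations.
Variables (k : fieldType) (n : nat) (c : 'I_n -> 'I_n -> 'I_n -> k).

Local Notation T i j := (free_gen k (i, j)).

(* [T i j] is the generator t^i_j: upper index first. *)
Definition comeasuring_relations : set (free_algebra k ('I_n * 'I_n)%type) :=
  fun r => exists i j l, r =
    \sum_a c i j a *: T l a - \sum_a \sum_b c a b l *: (T a i * T b j).

End Relations.

(* Main.v *)
(** Expanding a linear map [beta : A -> A ⊗ B] on the basis,
    [beta e_i = sum_a e_a ⊗ t a i], identifies algebra maps [beta] with matrices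
    [t] over [B] satisfying the comeasuring relations.  Let [F] be the free
    unital algebra on the [t i j] and [J] the ideal of the relations, which lies
    in the augmentation ideal [F+].  Then [F+ / J] with its generic matrix is an
    initial comeasuring: a matrix [t] over [B] yields a map from [F] to the
    unitization of [B], hence a nonunital map on [F+].  Any other initial
    comeasuring [M] is isomorphic to [F+ / J], so the unitization of [M] is
    [F / J].  The formulas for the coproduct and the counit follow by comparing
    coefficients of the [e_i] in their defining equations. *)

Require Import Defs.
From HB Require Import structures.
From mathcomp Require Import all_boot all_algebra finmap.
From mathcomp Require Import monalg.
From mathcomp Require Import boolp classical_sets.

Set Implicit Arguments.
Unset Strict Implicit.
Unset Printing Implicit Defensive.

Import GRing.Theory.

Local Open Scope ring_scope.

Section NonunitalAlgebra.
Variables (k : fieldType) (A : nualgType k).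

HB.instance Definition _ (x : A) :=
  GRing.isLinear.Build k A A *:%R (numul x) (numul_linearr x).

Lemma numul0l (x : A) : 0 ** x = 0.
Proof.
by have := numul_linearl x (-1) 0 0; rewrite scaler0 addr0 scaleN1r addNr.
Qed.

Lemma numulDl (x y z : A) : (x + y) ** z = x ** z + y ** z.
Proof. by have := numul_linearl z 1 x y; rewrite !scale1r. Qed.

Lemma numulZr a (x y : A) : x ** (a *: y) = a *: (x ** y).
Proof. exact: linearZ. Qed.

Lemma numul_suml (I : finType) (F : I -> A) y :
  (\sum_i F i) ** y = \sum_i F i ** y.
Proof.
by apply: (big_morph (numul^~ y)) => [u v|]; rewrite (numul0l, numulDl).
Qed.

Lemma numorphism_of (B : nualgType k) (f : A -> B) :
  linear f -> {morph f : x y / x ** y} -> exists g : {nualg A -> B}, g =1 f.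
Proof.
move=> fl fM; pose lm := GRing.isLinear.Build k A B *:%R f fl.
pose mm := isNuMultiplicative.Build k A B f fM.
pose g : {nualg A -> B} := HB.pack f lm mm.
by exists g.
Qed.

Lemma unitization_scaleAr (a : k) (x y : unitization A) :
  a *: (x * y) = x * (a *: y).
Proof.
case: x y => [b x] [c y]; apply: (congr2 pair); first exact: mulrCA.
by rewrite /= !scalerDr numulZr !scalerA [b * a]mulrC.
Qed.

HB.instance Definition _ :=
  GRing.Lalgebra_isAlgebra.Build k (unitization A) unitization_scaleAr.

Lemma unit_injM (x y : A) : unit_inj x * unit_inj y = unit_inj (x ** y).
Proof.
rewrite -[LHS]/(unit_mul (unit_inj x) (unit_inj y)) /unit_mul /= mul0r.
by rewrite !scale0r !add0r.
Qed.

End NonunitalAlgebra.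

Section Tensor.
Variables (k : fieldType) (V W : lmodType k).

HB.instance Definition _ (v : V) :=
  GRing.isLinear.Build k W (tensor V W) *:%R (tens v) (tens_linearr v).

Lemma tens0l (w : W) : (0 : V) ⊗ w = 0.
Proof.
by have := tens_linearl w (-1) (0 : V) 0; rewrite scaler0 addr0 scaleN1r addNr.
Qed.

Lemma tensDl (u v : V) (w : W) : (u + v) ⊗ w = u ⊗ w + v ⊗ w.
Proof. by have := tens_linearl w 1 u v; rewrite !scale1r. Qed.

Lemma tensZl a (v : V) (w : W) : (a *: v) ⊗ w = a *: (v ⊗ w).
Proof. by have := tens_linearl w a v 0; rewrite tens0l !addr0. Qed.

Lemma tensZr a (v : V) (w : W) : v ⊗ (a *: w) = a *: (v ⊗ w).
Proof. exact: linearZ. Qed.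

Lemma tens_suml (I : finType) (F : I -> V) (w : W) :
  (\sum_i F i) ⊗ w = \sum_i F i ⊗ w.
Proof.
by apply: (big_morph (fun v => v ⊗ w)) => [u v|]; rewrite (tens0l, tensDl).
Qed.

End Tensor.

HB.instance Definition _ (k : fieldType) (U V W : lmodType k) :=
  GRing.isLinear.Build k _ _ *:%R (@tensor_assoc k U V W)
    (@tensor_assoc_linear k U V W).

Section TensorMorphism.
Variable k : fieldType.

Lemma tensor_mulE (A B : nualgType k) (a a' : A) (b b' : B) :
  (a ⊗ b) ** (a' ⊗ b') = (a ** a') ⊗ (b ** b').
Proof. exact: tensor_mul_tens. Qed.

Lemma tensor_morphM (A B C : nualgType k) (f : {linear tensor A B -> C}) :
  (forall a b a' b',
     f ((a ** a') ⊗ (b ** b')) = f (a ⊗ b) ** f (a' ⊗ b')) ->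
  {morph f : x y / x ** y}.
Proof.
move=> fM x y; move: x; apply: tensor_linear_ext => [||a b].
- by move=> c u v; rewrite numul_linearl linearP.
- by move=> c u v; rewrite linearP numul_linearl.
move: y; apply: tensor_linear_ext => [||a' b'].
- by move=> c u v; rewrite numul_linearr linearP.
- by move=> c u v; rewrite linearP numul_linearr.
by rewrite tensor_mulE fM.
Qed.

Lemma tensor_map_morphM (A B A' B' : nualgType k)
    (f : {linear A -> A'}) (g : {linear B -> B'}) :
  {morph f : x y / x ** y} -> {morph g : x y / x ** y} ->
  {morph tensor_map f g : x y / x ** y}.
Proof.
move=> fM gM; apply: tensor_morphM => a b a' b'.
by rewrite /= !tensor_map_tens fM gM tensor_mulE.
Qed.

Lemma tensor_assoc_morphM (A B C : nualgType k) :
  {morph @tensor_assoc k A B C : x y / x ** y}.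
Proof.
apply: tensor_morphM => x c y c'.
move: x; apply: tensor_linear_ext => [||a b].
- by move=> d u v; rewrite numul_linearl tens_linearl linearP.
- by move=> d u v; rewrite tens_linearl linearP numul_linearl.
move: y; apply: tensor_linear_ext => [||a' b'].
- by move=> d u v; rewrite numul_linearr tens_linearl linearP.
- by move=> d u v; rewrite tens_linearl linearP numul_linearr.
by rewrite tensor_mulE /= !tensor_assoc_tens !tensor_mulE.
Qed.

End TensorMorphism.

Section Coefficients.
Variables (k : fieldType) (A : vectType k) (n : nat) (e : n.-tuple A).
Hypothesis e_basis : basis_of fullv e.

Lemma linear_eq_basis (Z : lmodType k) (f g : A -> Z) :
  linear f -> linear g -> (forall i : 'I_n, f e`_i = g e`_i) -> f =1 g.
Proof.
move=> fl gl fg v; rewrite (coord_basis e_basis (memvf v)).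
pose F : {linear A -> Z} := HB.pack f (GRing.isLinear.Build k A Z *:%R f fl).
pose G : {linear A -> Z} := HB.pack g (GRing.isLinear.Build k A Z *:%R g gl).
rewrite -[f]/(F : A -> Z) -[g]/(G : A -> Z) !linear_sum.
by apply: eq_bigr => i _; rewrite !linearZ /= fg.
Qed.

Section OneSpace.
Variable W : lmodType k.

Definition tensor_coef (i : 'I_n) : tensor A W -> W :=
  tensor_lift (fun v w => coord e i v *: w).

Let linl i (w : W) : linear (fun v => coord e i v *: w).
Proof. by move=> a u v; rewrite linearP scalerDl scalerA. Qed.

Let linr i (v : A) : linear (fun w : W => coord e i v *: w).
Proof. by move=> a u w; rewrite scalerDr !scalerA mulrC. Qed.

Lemma tensor_coef_linear i : linear (tensor_coef i).
Proof. exact: tensor_lift_linear. Qed.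

HB.instance Definition _ i :=
  GRing.isLinear.Build k _ _ *:%R (tensor_coef i) (tensor_coef_linear i).

Lemma tensor_coef_tens i v w : tensor_coef i (v ⊗ w) = coord e i v *: w.
Proof. exact: tensor_lift_tens. Qed.

Lemma tensor_coef_sum i (w : 'I_n -> W) :
  tensor_coef i (\sum_(a < n) e`_a ⊗ w a) = w i.
Proof.
rewrite linear_sum (bigD1 i) //= big1 => [|a ne_ai]; rewrite tensor_coef_tens.
  by rewrite coord_free ?(basis_free e_basis) // eqxx scale1r addr0.
by rewrite coord_free ?(basis_free e_basis) // (negbTE ne_ai) scale0r.
Qed.

Lemma tensor_coefE x : x = \sum_(i < n) e`_i ⊗ tensor_coef i x.
Proof.
move: x; apply: tensor_linear_ext => [||v w].
- by [].
- move=> a x y; rewrite scaler_sumr -big_split; apply: eq_bigr => i _.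
  by rewrite !linearP.
rewrite {1}(coord_basis e_basis (memvf v)) tens_suml; apply: eq_bigr => i _.
by rewrite tensor_coef_tens linearZ tensZl.
Qed.

End OneSpace.

Lemma tensor_map_sum (W W' : lmodType k) (f : {linear W -> W'}) (w : 'I_n -> W) :
  tensor_map idfun f (\sum_(i < n) e`_i ⊗ w i) = \sum_(i < n) e`_i ⊗ f (w i).
Proof.
by rewrite linear_sum; apply: eq_bigr => i _; rewrite /= tensor_map_tens.
Qed.

End Coefficients.

Lemma malgZU (K : choiceType) (R : nzRingType) (a b : R) (m : K) :
  a *: << b *g m >> = << a * b *g m >>.
Proof. by apply/malgP => m'; rewrite mcoeffZ !mcoeffU mulrnAr. Qed.

Section FreeAlgebra.
Variables (k : fieldType) (I : choiceType).

Local Notation F := (free_algebra k I).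

Lemma free_algebra_scaleAr (a : k) (x y : F) : a *: (x * y) = x * (a *: y).
Proof.
rewrite (@malgME _ _ x y) (malgMEw (fsubset_refl _) (msuppZ_le a y)).
rewrite scaler_sumr; apply: eq_bigr => u _.
rewrite scaler_sumr; apply: eq_bigr => v _.
by rewrite mcoeffZ mulrCA malgZU.
Qed.

Lemma free_algebra_ind (P : F -> Prop) :
  (forall a x y, P x -> P y -> P (a *: x + y)) -> P 0 -> P 1 ->
  (forall i x, P x -> P (free_gen k i * x)) -> forall x, P x.
Proof.
move=> PD P0 P1 PM x.
have Pw s : P << FMonom s >>.
  elim: s => [|i s IHs]; first by rewrite -(fmoneE I).
  have -> : << FMonom (i :: s) >> = free_gen k i * << FMonom s >> :> F.
    rewrite /free_gen malgME !msuppU1 !big_seq_fset1 !mcoeffUU mulr1.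
    by congr << _ *g _ >>; apply/eqP; rewrite fmP fmM fmU.
  exact: PM.
rewrite (monalgE x); apply: big_ind => //= [u v Pu Pv|m _].
  by rewrite -[u]scale1r; apply: PD.
have -> : << x@_m *g m >> = x@_m *: << m >> + 0 :> F.
  by rewrite addr0 malgZU mulr1.
by apply: PD => //; rewrite -(fmK m); apply: Pw.
Qed.

Lemma free_algebra_lift (C : algType k) (h : I -> C) :
  exists phi : {lrmorphism F -> C}, forall i, phi (free_gen k i) = h i.
Proof.
pose w (m : {fmonom I}) : C := \prod_(i <- (m : seq I)) h i.
have w_morph : monalg.mmorphism w.
  by split=> [u v|]; rewrite /w ?fmM ?big_cat // fm1 big_nil.
pose wM : {mmorphism {fmonom I} -> C} :=
  HB.pack w (monalg.isMultiplicative.Build _ _ w w_morph).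
pose f : {rmorphism k -> C} := in_alg C.
pose phi : F -> C := mmap f wM.
have phi_lin : linear phi.
  by move=> a x y; rewrite /phi mmapD mmapZ /= mulr_algl.
have phi_mul : monoid_morphism phi.
  have [phiM phi1] : multiplicative phi; last by split.
  apply: commr_mmap_is_multiplicative => g m m'.
  by rewrite /GRing.comm /= mulr_algl mulr_algr.
pose phiL := GRing.isLinear.Build k F C *:%R phi phi_lin.
pose phiM := GRing.isMonoidMorphism.Build F C phi phi_mul.
pose Phi : {lrmorphism F -> C} := HB.pack phi phiL phiM.
exists Phi => i /=; rewrite /phi /free_gen mmapU /= scale1r mul1r /w.
by rewrite fmU big_seq1.
Qed.

End FreeAlgebra.

Section GeneratedIdeal.
Variables (F : nzRingType) (R : set F).

Lemma generated_ideal_two_sided : two_sided_ideal (generated_ideal R).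
Proof.
split=> [J [] //|x y Rx Ry J JI RJ|a x Rx J JI RJ|a x Rx J JI RJ];
  have [_ JD JMl JMr] := JI.
- by apply: JD; [apply: (Rx J) | apply: (Ry J)].
- by apply: JMl; apply: (Rx J).
- by apply: JMr; apply: (Rx J).
Qed.

Lemma sub_generated_ideal : (R `<=` generated_ideal R)%classic.
Proof. by move=> x Rx J _; apply. Qed.

Lemma generated_ideal_ker (C : nzRingType) (phi : {rmorphism F -> C}) :
  (forall r, R r -> phi r = 0) -> forall x, generated_ideal R x -> phi x = 0.
Proof.
move=> phiR x /(_ (fun y => phi y = 0)); apply=> [|r /phiR //].
split=> [|u v u0 v0|a u u0|a u u0]; first exact: rmorph0.
- by rewrite rmorphD u0 v0 addr0.
- by rewrite rmorphM u0 mulr0.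
- by rewrite rmorphM u0 mul0r.
Qed.

End GeneratedIdeal.

Lemma two_sided_idealZ (k : fieldType) (F : lalgType k) (J : set F) a x :
  two_sided_ideal J -> J x -> J (a *: x).
Proof. by case=> _ _ JM _ Jx; rewrite -mulr_algl; apply: JM. Qed.

(* The quotient of the augmentation ideal of [F] by [J] is realized as the
   quotient of [F] itself by [k 1 + J], so that no subtype of [F] is needed. *)
Section AugmentedQuotient.
Variables (k : fieldType) (F : lalgType k).
Variables (eps : {lrmorphism F -> k^o}) (J : set F).

Definition reduced (x : F) : F := x - (eps x : k)%:A.

Lemma eps_reduced x : eps (reduced x) = 0.
Proof. by rewrite /reduced linearB linearZ /= rmorph1 [_ *: _]mulr1 subrr. Qed.

Lemma reduced_id x : eps x = 0 -> reduced x = x.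
Proof. by rewrite /reduced => ->; rewrite scale0r subr0. Qed.

Lemma reducedM x y : reduced (reduced x * reduced y) = reduced x * reduced y.
Proof. by apply: reduced_id; rewrite rmorphM /= eps_reduced mul0r. Qed.

Lemma reduced_linear : linear reduced.
Proof.
move=> a x y; rewrite /reduced linearP /= scalerDl -[_ *: eps x]/(a * eps x).
by rewrite -scalerA scalerBr opprD addrACA.
Qed.

HB.instance Definition _ :=
  GRing.isLinear.Build k F F *:%R reduced reduced_linear.

Hypothesis F_scaleAr : forall (a : k) (x y : F), a *: (x * y) = x * (a *: y).
Hypothesis J_ideal : two_sided_ideal J.

Let null_set : set F := fun x => J (reduced x).

Let null_set_subspace : subspace null_set.
Proof.
have [J0 JD _ _] := J_ideal; split=> [|a u v Nu Nv]; rewrite /null_set.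
  by rewrite linear0.
by rewrite linearP; apply: JD => //; apply: two_sided_idealZ.
Qed.

Local Notation Q := (quot null_set).

Let pi_eqP x y :
  quot_pi null_set x = quot_pi null_set y <-> J (reduced x - reduced y).
Proof.
rewrite -linearB; split=> [/quot_piP xy | xy].
  exact: (xy null_set null_set_subspace).
by apply/quot_piP; apply: sub_spanned.
Qed.

Let mul : Q -> Q -> Q :=
  locked (fun x y => quot_pi _ (reduced (repr x) * reduced (repr y))).

Let mulE x y :
  mul (quot_pi _ x) (quot_pi _ y) = quot_pi _ (reduced x * reduced y).
Proof.
have [J0 JD JMl JMr] := J_ideal.
rewrite /mul -lock; apply/pi_eqP.
set x' := repr _; set y' := repr _.
have x'E : J (reduced x' - reduced x) by apply/pi_eqP; rewrite quot_reprK.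
have y'E : J (reduced y' - reduced y) by apply/pi_eqP; rewrite quot_reprK.
rewrite !reducedM -(subrKA (reduced x * reduced y')) -mulrBl -mulrBr.
by apply: JD; [apply: JMr | apply: JMl].
Qed.

Let mul_assoc : associative mul.
Proof.
elim/quotW => x; elim/quotW => y; elim/quotW => z.
by rewrite !mulE !reducedM mulrA.
Qed.

Let mul_linearl y : linear (mul^~ y).
Proof.
move=> a; elim/quotW => u; elim/quotW => v; elim/quotW: y => y.
rewrite -quot_pi_linear !mulE -quot_pi_linear.
by rewrite reduced_linear mulrDl scalerAl.
Qed.

Let mul_linearr x : linear (mul x).
Proof.
move=> a; elim/quotW => u; elim/quotW => v; elim/quotW: x => x.
rewrite -quot_pi_linear !mulE -quot_pi_linear.
by rewrite reduced_linear mulrDr F_scaleAr.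
Qed.

Lemma augmented_quotient_exists :
  exists (T : nualgType k) (cl : {linear F -> T}),
    [/\ forall t, exists x, cl x = t,
        forall x, cl x = 0 <-> J (reduced x)
      & forall x y, cl x ** cl y = cl (reduced x * reduced y)].
Proof.
pose T : nualgType k := HB.pack (quot null_set)
  (Lmodule_isNuAlg.Build k (quot null_set) mul_assoc mul_linearl mul_linearr).
exists T, (quot_pi null_set : {linear F -> quot null_set}); split=> [||x y].
- by elim/quotW => x; exists x.
- move=> x; rewrite -[X in _ = X](linear0 (quot_pi null_set)) pi_eqP.
  by rewrite linear0 subr0.
- exact: mulE.
Qed.

End AugmentedQuotient.

Section AugmentedQuotientLift.
Variables (k : fieldType) (F : lalgType k) (eps : {lrmorphism F -> k^o}).
Variables (T : nualgType k) (cl : {linear F -> T}).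
Hypothesis cl_surj : forall t, exists x, cl x = t.
Hypothesis clM : forall x y, cl x ** cl y = cl (reduced eps x * reduced eps y).

Lemma augmented_quotient_lift (B : nualgType k)
    (phi : {lrmorphism F -> unitization B}) :
  (forall x, (phi x).1 = eps x) ->
  (forall x, cl x = 0 -> phi (reduced eps x) = 0) ->
  exists f : {nualg T -> B}, forall x, f (cl x) = (phi x).2.
Proof.
move=> phi1 phi0; have [s sK] := choice cl_surj.
have phi_red x : phi (reduced eps x) = unit_inj (phi x).2.
  rewrite /reduced linearB linearZ rmorph1 /=.
  apply: (congr2 pair); first by rewrite /= phi1 [_ *: _]mulr1 subrr.
  by rewrite /= scaler0 subr0.
have wd x y : cl x = cl y -> (phi x).2 = (phi y).2.
  move=> /eqP; rewrite -subr_eq0 -linearB => /eqP /phi0.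
  by rewrite phi_red => -[] /eqP; rewrite linearB subr_eq0 => /eqP.
pose g t := (phi (s t)).2.
have gE x : g (cl x) = (phi x).2 by apply: wd; rewrite sK.
have g_lin : linear g.
  move=> a u v; rewrite -(sK u) -(sK v) -linearP !gE.
  by rewrite linearP.
have gM : {morph g : u v / u ** v}.
  move=> u v; rewrite -(sK u) -(sK v) clM !gE.
  have -> // : phi (reduced eps (s u) * reduced eps (s v)) =
      unit_inj ((phi (s u)).2 ** (phi (s v)).2).
  by rewrite -unit_injM -!phi_red rmorphM.
have [f fE] := numorphism_of g_lin gM.
by exists f => x; rewrite fE.
Qed.

End AugmentedQuotientLift.

Lemma nualg_presentation (k : fieldType) (I : choiceType)
    (R : set (free_algebra k I)) :
  exists (eps : {lrmorphism free_algebra k I -> k^o}) (T : nualgType k)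
      (cl : {linear free_algebra k I -> T}),
    [/\ forall u, exists x, cl x = u,
        forall i, eps (free_gen k i) = 0,
        forall i j, cl (free_gen k i) ** cl (free_gen k j) =
          cl (free_gen k i * free_gen k j),
        forall x, eps x = 0 -> cl x = 0 <-> generated_ideal R x
      & (forall (B : nualgType k)
            (phi : {lrmorphism free_algebra k I -> unitization B}) h,
          (forall i, phi (free_gen k i) = unit_inj (h i)) ->
          (forall r, R r -> phi r = 0) ->
          (forall x, (phi x).1 = eps x) /\
          exists f : {nualg T -> B}, forall x, f (cl x) = (phi x).2)
        /\ (forall (B : nualgType k) (f g : {nualg T -> B}),
          (forall i, f (cl (free_gen k i)) = g (cl (free_gen k i))) -> f =1 g)].
Proof.
have [eps eps_gen] := @free_algebra_lift k I k^o (fun=> 0).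
have RI := generated_ideal_two_sided R.
have [T [cl [cl_surj cl0 clM]]] :=
  augmented_quotient_exists eps (@free_algebra_scaleAr k I) RI.
have red_gen i : reduced eps (free_gen k i) = free_gen k i.
  by apply: reduced_id.
exists eps, T, cl; split=> [//|//|i j|x x0|];
  last split=> [B phi h phi_gen phiR|B f g fg].
- by rewrite clM !red_gen.
- by rewrite cl0 reduced_id.
- have phi1 x : (phi x).1 = eps x.
    move: x; apply: free_algebra_ind => [a x y xE yE|||i x _].
    + by rewrite !linearP /= xE yE.
    + by rewrite !linear0.
    + by rewrite !rmorph1.
    + rewrite !rmorphM /= eps_gen mul0r phi_gen.
      exact: mul0r.
  split=> //; apply: (augmented_quotient_lift cl_surj clM) => // x /cl0.
  exact: generated_ideal_ker.
- move=> t; have [x <-] := cl_surj t; move: x {t}.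
  apply: free_algebra_ind => [a x y xE yE|||i x xE].
  + by rewrite !linearP /= xE yE.
  + by rewrite linear0 !linear0.
  + have -> : cl 1 = 0; last by rewrite !linear0.
    apply/cl0; rewrite /reduced rmorph1 scale1r subrr.
    by case: RI.
  + have -> : free_gen k i * x =
        reduced eps (free_gen k i) * reduced eps x + (eps x : k) *: free_gen k i.
      by rewrite red_gen /reduced mulrBr -free_algebra_scaleAr mulr1 subrK.
    rewrite !linearD !linearZ /= -clM !numorphM.
    by rewrite xE fg.
Qed.

Lemma nucomp_exists (k : fieldType) (A B C : nualgType k)
    (g : {nualg B -> C}) (f : {nualg A -> B}) :
  exists h : {nualg A -> C}, h =1 g \o f.
Proof.
apply: numorphism_of => [a x y|x y] /=; first by rewrite !linearP.
by rewrite !numorphM.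
Qed.

Lemma comeasuring_bialgebra_of_universal (k : fieldType) (A M : nualgType k)
    (coact : {nualg A -> tensor A M}) :
  (forall (B : nualgType k) (beta : {nualg A -> tensor A B}),
    exists2 pi : {nualg M -> B},
      forall a, beta a = tensor_map idfun pi (coact a)
    & forall pi' : {nualg M -> B},
      (forall a, beta a = tensor_map idfun pi' (coact a)) -> pi' =1 pi) ->
  inhabited (comeasuring_bialgebra A).
Proof.
move=> univ.
pose beta2 a := tensor_assoc (tensor_map coact idfun (coact a)).
have [|x y|b2 b2E] := @numorphism_of _ _ _ beta2.
- by move=> a x y; rewrite /beta2 !linearP.
- have coactM := @tensor_map_morphM k A M _ M coact idfun
    (@numorphM _ _ _ coact) (fun _ _ => erefl).
  by rewrite /beta2 numorphM coactM; apply: tensor_assoc_morphM.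
pose beta0 (a : A) : tensor A k^o := a ⊗ (1 : k^o).
have [|x y|b0 b0E] := @numorphism_of _ _ _ beta0.
- exact: tens_linearl.
- rewrite /beta0 tensor_mulE; congr (_ ⊗ _); exact/esym/mulr1.
have [Delta DeltaE _] := univ _ b2; have [eps epsE _] := univ _ b0.
constructor; apply: (@Build_comeasuring_bialgebra _ _ M coact univ Delta _ eps).
- by move=> a; rewrite -DeltaE b2E.
- by move=> a; rewrite -epsE b0E.
Qed.

Section Matrices.
Variables (k : fieldType) (A : nufalgType k) (n : nat).
Variables (e : n.-tuple A) (c : 'I_n -> 'I_n -> 'I_n -> k).
Hypothesis e_basis : basis_of fullv e.
Hypothesis e_mul : forall i j : 'I_n, e`_i ** e`_j = \sum_(l < n) c i j l *: e`_l.

Definition coact_matrix (B : nualgType k) (beta : A -> tensor A B) : 'M[B]_n :=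
  \matrix_(a, i) tensor_coef e a (beta e`_i).

Definition comeasuring_matrix (B : nualgType k) (t : 'M[B]_n) :=
  forall i j l, \sum_a c i j a *: t l a =
    \sum_a \sum_b c a b l *: (t a i ** t b j).

Lemma mul_basis_tens (B : nualgType k) (u v : 'I_n -> B) :
  (\sum_(a < n) e`_a ⊗ u a) ** (\sum_(b < n) e`_b ⊗ v b) =
  \sum_(l < n) e`_l ⊗ (\sum_a \sum_b c a b l *: (u a ** v b)).
Proof.
rewrite numul_suml.
under eq_bigr => a _.
  rewrite linear_sum.
  under eq_bigr => b _ do rewrite /= tensor_mulE e_mul tens_suml.
  rewrite exchange_big; over.
rewrite exchange_big; apply: eq_bigr => l _ /=; rewrite linear_sum.
apply: eq_bigr => a _; rewrite linear_sum; apply: eq_bigr => b _.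
by rewrite /= tensZl tensZr.
Qed.

Lemma comeasuring_matrix_coact (B : nualgType k)
    (beta : {nualg A -> tensor A B}) :
  comeasuring_matrix (coact_matrix beta).
Proof.
move=> i j l; have := congr1 (tensor_coef e l \o beta) (e_mul i j).
rewrite /= numorphM [beta e`_i](tensor_coefE e_basis).
rewrite [beta e`_j](tensor_coefE e_basis) mul_basis_tens.
rewrite (tensor_coef_sum e_basis) !linear_sum /= => E.
under eq_bigr => a _ do rewrite mxE.
under [RHS]eq_bigr => a _ do under eq_bigr => b _ do rewrite !mxE.
rewrite E; apply: eq_bigr => a _; by rewrite !linearZ.
Qed.

Lemma coact_of_comeasuring_matrix (B : nualgType k) (t : 'M[B]_n) :
  comeasuring_matrix t -> exists beta : {nualg A -> tensor A B},
    forall i : 'I_n, beta e`_i = \sum_(a < n) e`_a ⊗ t a i.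
Proof.
move=> tP.
pose beta (v : A) := \sum_(i < n) coord e i v *: \sum_(a < n) e`_a ⊗ t a i.
have beta_lin : linear beta.
  move=> a u v; rewrite /beta scaler_sumr -big_split; apply: eq_bigr => i _.
  by rewrite linearP scalerDl scalerA.
have beta_e (i : 'I_n) : beta e`_i = \sum_(a < n) e`_a ⊗ t a i.
  rewrite /beta (bigD1 i) //= [X in _ + X]big1 => [|j ne_ji];
    rewrite coord_free ?(basis_free e_basis) //.
    by rewrite eqxx scale1r addr0.
  by rewrite eq_sym (negbTE ne_ji) scale0r.
pose b : {linear A -> tensor A B} := HB.pack beta
  (GRing.isLinear.Build k A (tensor A B) *:%R beta beta_lin).
have bM_e (i j : 'I_n) : b (e`_i ** e`_j) = b e`_i ** b e`_j.
  rewrite /= !beta_e mul_basis_tens e_mul -[beta _]/(b _) linear_sum /=.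
  under eq_bigr => a _.
    rewrite -[beta _]/(b _) linearZ /= beta_e scaler_sumr; over.
  rewrite exchange_big; apply: eq_bigr => l _ /=; rewrite -tP linear_sum.
  by apply: eq_bigr => a _; rewrite /= tensZr.
have bM : {morph b : u v / u ** v}.
  move=> u v; move: u; apply: (linear_eq_basis e_basis) => [||i].
  - by move=> a x y; rewrite numul_linearl linearP.
  - by move=> a x y; rewrite linearP numul_linearl.
  move: v; apply: (linear_eq_basis e_basis) => [||j].
  - by move=> a x y; rewrite numul_linearr linearP.
  - by move=> a x y; rewrite linearP numul_linearr.
  exact: bM_e.
have [f fE] := numorphism_of beta_lin bM.
by exists f => i; rewrite fE beta_e.
Qed.

End Matrices.

Section Relations.
Variables (k : fieldType) (n : nat) (c : 'I_n -> 'I_n -> 'I_n -> k).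

Local Notation F := (free_algebra k ('I_n * 'I_n)%type).

Lemma comeasuring_relations_ker (B : nualgType k) (t : 'M[B]_n)
    (phi : {lrmorphism F -> unitization B}) :
  (forall ij, phi (free_gen k ij) = unit_inj (t ij.1 ij.2)) ->
  comeasuring_matrix c t -> forall r, comeasuring_relations c r -> phi r = 0.
Proof.
move=> phi_gen tP _ [i [j [l ->]]]; rewrite linearB; apply/eqP.
rewrite subr_eq0; apply/eqP.
transitivity (unit_inj (\sum_a c i j a *: t l a)).
  rewrite !linear_sum; apply: eq_bigr => a _.
  by rewrite !linearZ /= phi_gen.
rewrite tP !linear_sum; apply: eq_bigr => a _.
rewrite !linear_sum; apply: eq_bigr => b _.
by rewrite !linearZ rmorphM /= !phi_gen unit_injM.
Qed.

Lemma comeasuring_matrix_gen (eps : {lrmorphism F -> k^o}) (T : nualgType k)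
    (cl : {linear F -> T}) :
  (forall ij, eps (free_gen k ij) = 0) ->
  (forall ij pq, cl (free_gen k ij) ** cl (free_gen k pq) =
    cl (free_gen k ij * free_gen k pq)) ->
  (forall x, eps x = 0 ->
    cl x = 0 <-> generated_ideal (comeasuring_relations c) x) ->
  comeasuring_matrix c (\matrix_(i, j) cl (free_gen k (i, j))).
Proof.
move=> eps_gen clM cl0 i j l.
under eq_bigr => a _ do rewrite mxE.
under [RHS]eq_bigr => a _ do under eq_bigr => b _ do rewrite !mxE.
pose r : F := \sum_a c i j a *: free_gen k (l, a) -
  \sum_a \sum_b c a b l *: (free_gen k (a, i) * free_gen k (b, j)).
have r0 : cl r = 0.
  apply/cl0; last by apply: sub_generated_ideal; exists i, j, l.
  have eps_l : eps (\sum_a c i j a *: free_gen k (l, a)) = 0.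
    rewrite linear_sum; apply: big1 => a _.
    by rewrite linearZ /= eps_gen scaler0.
  have eps_r : eps (\sum_a \sum_b
      c a b l *: (free_gen k (a, i) * free_gen k (b, j))) = 0.
    rewrite linear_sum; apply: big1 => a _.
    rewrite linear_sum; apply: big1 => b _.
    by rewrite linearZ rmorphM /= !eps_gen mul0r scaler0.
  by rewrite /r linearB /= eps_l eps_r subrr.
transitivity (cl (\sum_a c i j a *: free_gen k (l, a))).
  by rewrite linear_sum; apply: eq_bigr => a _; rewrite linearZ.
transitivity (cl (\sum_a \sum_b
    c a b l *: (free_gen k (a, i) * free_gen k (b, j)))).
  by apply/eqP; rewrite -subr_eq0 -linearB -[X in cl X]/r r0.
rewrite linear_sum; apply: eq_bigr => a _.
by rewrite linear_sum; apply: eq_bigr => b _; rewrite linearZ clM.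
Qed.

End Relations.

Section Universal.
Variables (k : fieldType) (A : nufalgType k) (n : nat).
Variables (e : n.-tuple A) (c : 'I_n -> 'I_n -> 'I_n -> k).
Hypothesis e_basis : basis_of fullv e.
Hypothesis e_mul : forall i j : 'I_n, e`_i ** e`_j = \sum_(l < n) c i j l *: e`_l.

Local Notation F := (free_algebra k ('I_n * 'I_n)%type).

Lemma coact_matrixE (B : nualgType k) (beta : A -> tensor A B) (i : 'I_n) :
  beta e`_i = \sum_(a < n) e`_a ⊗ coact_matrix e beta a i.
Proof.
by rewrite [LHS](tensor_coefE e_basis); apply: eq_bigr => a _; rewrite mxE.
Qed.

Lemma tensor_map_coact_matrixP (M B : nualgType k)
    (beta : {nualg A -> tensor A M}) (beta' : {nualg A -> tensor A B}) (f : {nualg M -> B}) :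
  (forall a, beta' a = tensor_map idfun f (beta a)) <->
  (forall i j, coact_matrix e beta' i j = f (coact_matrix e beta i j)).
Proof.
split=> [H i j|H].
  rewrite [LHS]mxE H (coact_matrixE beta j) tensor_map_sum.
  by rewrite (tensor_coef_sum e_basis).
apply: (linear_eq_basis e_basis) => [a x y|a x y|i]; try by rewrite !linearP.
rewrite (coact_matrixE beta i) tensor_map_sum coact_matrixE.
by apply: eq_bigr => a _; rewrite H.
Qed.

Lemma comeasuring_presentation :
  exists (eps : {lrmorphism F -> k^o}) (T : nualgType k) (cl : {linear F -> T})
      (coact : {nualg A -> tensor A T}),
    [/\ forall i j, coact_matrix e coact i j = cl (free_gen k (i, j)),
        forall u, exists x, cl x = u,
        forall x, eps x = 0 -> cl x = 0 ->
          generated_ideal (comeasuring_relations c) x,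
        forall (B : nualgType k) (beta : {nualg A -> tensor A B})
            (phi : {lrmorphism F -> unitization B}),
          (forall ij,
             phi (free_gen k ij) = unit_inj (coact_matrix e beta ij.1 ij.2)) ->
          (forall x, (phi x).1 = eps x) /\
          exists f : {nualg T -> B}, forall x, f (cl x) = (phi x).2
      & forall (B : nualgType k) (f g : {nualg T -> B}),
          (forall i j,
             f (coact_matrix e coact i j) = g (coact_matrix e coact i j)) ->
          f =1 g].
Proof.
have [eps [T [cl [cl_surj eps_gen clM cl0 [lift uniq]]]]] :=
  nualg_presentation (comeasuring_relations c).
have [coact coactE] := coact_of_comeasuring_matrix e_basis e_mul
  (comeasuring_matrix_gen eps_gen clM cl0).
have coact_gen i j : coact_matrix e coact i j = cl (free_gen k (i, j)).
  by rewrite mxE coactE (tensor_coef_sum e_basis) mxE.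
exists eps, T, cl, coact; split=> // [x x0|B beta phi phi_gen|B f g fg].
- by move/cl0; apply.
- apply: (lift _ _ _ phi_gen); apply: (comeasuring_relations_ker phi_gen).
  exact: comeasuring_matrix_coact.
- by apply: uniq => -[i j]; rewrite -coact_gen fg.
Qed.

Variable M : comeasuring_bialgebra A.
Local Notation t := (coact_matrix e (cm_coact M)).

Lemma cm_coprod_matrix i j : cm_coprod M (t i j) = \sum_a t i a ⊗ t a j.
Proof.
have := congr1 (tensor_coef e i) (cm_coprodE M e`_j).
rewrite [X in tensor_map idfun _ X](coact_matrixE (cm_coact M)) tensor_map_sum.
rewrite (tensor_coef_sum e_basis) => ->.
rewrite (coact_matrixE (cm_coact M)) !linear_sum; apply: eq_bigr => a _.
rewrite /= tensor_map_tens /= (coact_matrixE (cm_coact M)) tens_suml linear_sum.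
under eq_bigr => b _ do rewrite /= tensor_assoc_tens.
by rewrite (tensor_coef_sum e_basis).
Qed.

Lemma cm_counit_matrix i j : cm_counit M (t i j) = (i == j)%:R.
Proof.
have := congr1 (tensor_coef e i) (cm_counitE M e`_j).
rewrite [X in tensor_map idfun _ X](coact_matrixE (cm_coact M)) tensor_map_sum.
rewrite (tensor_coef_sum e_basis) tensor_coef_tens => <-.
by rewrite coord_free ?(basis_free e_basis) // [_ *: _]mulr1 eq_sym.
Qed.

End Universal.

Theorem proposition2p2 (k : fieldType) (A : nufalgType k) (n : nat)
    (e : n.-tuple A) (c : 'I_n -> 'I_n -> 'I_n -> k)
    (e_basis : basis_of fullv e)
    (e_mul : forall i j : 'I_n, e`_i ** e`_j = \sum_(l < n) c i j l *: e`_l) :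
  inhabited (comeasuring_bialgebra A) /\
  forall M : comeasuring_bialgebra A,
  exists t : 'M[M]_n,
    [/\ presented_by (fun ij => unit_inj (t ij.1 ij.2))
          (comeasuring_relations c),
        forall i j, extended_coprod M (unit_inj (t i j)) =
          \sum_a unit_inj (t i a) ⊗ unit_inj (t a j),
        forall i j, extended_counit M (unit_inj (t i j)) = (i == j)%:R
      & forall i : 'I_n, cm_coact M e`_i = \sum_(a < n) e`_a ⊗ t a i].
Proof.
have [eps [T [cl [coactT [coactT_gen cl_surj cl0 lift uniq]]]]] :=
  comeasuring_presentation e_basis e_mul.
have coordP := tensor_map_coact_matrixP e_basis.
split.
  apply: (@comeasuring_bialgebra_of_universal k A T coactT) => B beta.
  have [phi phi_gen] :=
    free_algebra_lift (fun ij => unit_inj (coact_matrix e beta ij.1 ij.2)).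
  have [phi1 [f fE]] := lift B beta phi phi_gen.
  have f_gen i j : coact_matrix e beta i j = f (coact_matrix e coactT i j).
    by rewrite coactT_gen fE phi_gen.
  exists f; first exact/coordP.
  by move=> g /coordP g_gen; apply: uniq => i j; rewrite -g_gen f_gen.
move=> M; pose t := coact_matrix e (cm_coact M); exists t.
have tE (i : 'I_n) := coact_matrixE e_basis (cm_coact M) i.
split=> //.
- have [phi phi_gen] := free_algebra_lift (fun ij => unit_inj (t ij.1 ij.2)).
  have [phi1 [sigma sigmaE]] := lift M (cm_coact M) phi phi_gen.
  have [pi /coordP pi_gen _] := cm_universal M coactT.
  have sigma_gen i j : sigma (coact_matrix e coactT i j) = t i j.
    by rewrite coactT_gen sigmaE phi_gen.
  have [id_T id_TE] : exists f : {nualg T -> T}, f =1 id by exact: numorphism_of.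
  have [id_M id_ME] : exists f : {nualg M -> M}, f =1 id by exact: numorphism_of.
  have sigmaK : cancel sigma pi.
    have [h hE] := nucomp_exists pi sigma.
    move=> x; rewrite -[RHS]id_TE -[LHS]hE; move: x; apply: uniq => i j.
    by rewrite hE id_TE /= sigma_gen pi_gen.
  have piK : cancel pi sigma.
    have [h hE] := nucomp_exists sigma pi.
    have [f _ f_uniq] := cm_universal M (cm_coact M).
    move=> x; rewrite -[RHS]id_ME -[LHS]hE !f_uniq //; apply/coordP => i j.
      by rewrite id_ME.
    by rewrite hE /= -pi_gen sigma_gen.
  exists phi; split=> // [[a m]|p].
    have [q qE] := cl_surj (pi m).
    exists (q + (a - eps q : k)%:A); rewrite linearD linearZ rmorph1.
    apply: (congr2 pair); first by rewrite /= phi1 [_ *: _]mulr1 addrC subrK.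
    by rewrite /= -sigmaE qE piK scaler0 addr0.
  split=> [phip|]; last first.
    apply: generated_ideal_ker; apply: (comeasuring_relations_ker phi_gen).
    exact: comeasuring_matrix_coact.
  apply: cl0; first by rewrite -phi1 phip.
  by rewrite -[LHS]sigmaK sigmaE phip linear0.
- move=> i j; rewrite /extended_coprod /= scale0r add0r.
  rewrite cm_coprod_matrix // linear_sum.
  by apply: eq_bigr => a _; rewrite /= tensor_map_tens.
- move=> i j; rewrite /extended_counit /= add0r.
  exact: cm_counit_matrix.
Qed.
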